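(* Assume $\frac{np}{\sigma^2}>c_1$ and $\frac{np}{\log n}>c_2$ for some sufficiently large constants $c_1,c_2>0$. Then $$\inf_{\widehat{Z}\in\mathbb{R}^{n\times n}}\sup_{z\in\{-1,1\}^n}\mathbb{E}_z\frac{1}{n^2}\|\widehat{Z}-zz^{\mathrm T}\|_{\mathrm F}^2\geq \exp\left(-(1+\delta)\frac{np}{2\sigma^2}\right),$$ $$\inf_{\widehat{z}\in\{-1,1\}^n}\sup_{z\in\{-1,1\}^n}\mathbb{E}_z\ell(\widehat{z},z)\geq \exp\left(-(1+\delta)\frac{np}{2\sigma^2}\right),$$ where $\delta=C\sqrt{\frac{\log n+\sigma^2}{np}}$ for some constant $C>0$.
   Context: $\mathbb{Z}_2$ synchronization model. Let $\sigma>0$, $p\in(0,1]$. For a parameter $z\in\{-1,1\}^n$ and $1\le j<k\le n$, let $A_{jk}\sim\mathrm{Bernoulli}(p)$ and $W_{jk}\sim\mathcal N(0,1)$, all mutually independent, and $Y_{jk}=z_jz_k+\sigma W_{jk}$. The observed data are $\{A_{jk}\}_{1\le j<k\le n}$ and $\{A_{jk}Y_{jk}\}_{1\le j<k\le n}$; $\mathbb{E}_z$ is expectation when the true parameter is $z$. The infima are over all estimators, i.e. measurable functions of the observed data, taking values in $\mathbb{R}^{n\times n}$ (respectively $\{-1,1\}^n$). For $\widehat z,z\in\{-1,1\}^n$, $$\ell(\widehat z,z)=\min_{a\in\{-1,1\}}\frac1n\sum_{j=1}^n|\widehat z_j-z_ja|^2.$$ $\|\cdot\|_{\mathrm F}$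 is the Frobenius norm. ''Constants'' are absolute, i.e. independent of $n,p,\sigma$. *)

(* Defs.v *)
From mathcomp Require Import all_boot all_order all_algebra.
From mathcomp Require Import all_classical all_reals all_analysis.

Set Implicit Arguments.
Unset Strict Implicit.
Unset Printing Implicit Defensive.

Import Order.TTheory GRing.Theory Num.Theory.
Import numFieldNormedType.Exports.

Local Open Scope classical_set_scope.
Local Open Scope ring_scope.

(* The pairs j < k of vertices. *)
Definition edge (n : nat) : finType := {e : 'I_n * 'I_n | (e.1 < e.2)%N}.

(* Mutual independence of a finite family of classes of events: the product
   rule holds for every subfamily and every choice of events in the classes. *)
Definition mutually_independent d (Omega : measurableType d) (R : realType)
    (P : probability Omega R) (I : finType) (F : I -> set (set Omega)) : Prop :=
  forall (J : {set I}) (E : I -> set Omega),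
    (forall i, i \in J -> F i (E i)) ->
    P (\bigcap_(i in [set` J]) E i) = (\prod_(i in J) P (E i))%E.

(* The sigma-algebra generated by a random element. *)
Definition sigma_of d d' (T : measurableType d) (T' : measurableType d')
    (X : T -> T') : set (set T) :=
  preimage_set_system [set: T] X measurable.

Section Z2_synchronization.
Context (R : realType) (n : nat).

Definition noise_model (p : R) d (Omega : measurableType d)
    (P : probability Omega R) (A : edge n -> {RV P >-> bool})
    (W : edge n -> {RV P >-> R}) : Prop :=
  [/\ forall e B, measurable B -> distribution P (A e) B = bernoulli_prob p B,
      forall e B, measurable B -> distribution P (W e) B = normal_prob 0 1 B &
      mutually_independent P (fun i : edge n + edge n =>
        match i with inl e => sigma_of (A e) | inr e => sigma_of (W e) end)].

(* {-1, 1}^n, as column vectors. *)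
Definition sign_vectors : set 'cV[R]_n :=
  [set z | forall j, z j 0 = -1 \/ z j 0 = 1].

(* Values of the observation ((A_jk), (A_jk Y_jk)), both families being listed
   along the enumeration of the pairs j < k; the sigma-algebra is the product
   one. *)
Local Notation data := (#|edge n|.-tuple bool * #|edge n|.-tuple R)%type.

Definition Yobs (sigma : R) (z : 'cV[R]_n) Omega (W : edge n -> Omega -> R)
    (e : edge n) (w : Omega) : R :=
  z (val e).1 0 * z (val e).2 0 + sigma * W e w.

(* The observation when the true parameter is z. *)
Definition observed (sigma : R) (z : 'cV[R]_n) Omega
    (A : edge n -> Omega -> bool) (W : edge n -> Omega -> R) (w : Omega)
    : data :=
  ([tuple A (enum_val i) w | i < #|edge n|],
   [tuple (A (enum_val i) w)%:R * Yobs sigma z W (enum_val i) w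
     | i < #|edge n|]).

(* Borel measurability of a matrix-valued map is stated entrywise. *)
Definition matrix_estimators : set (data -> 'M[R]_n) :=
  [set Zhat | forall i j, measurable_fun [set: data] (fun y => Zhat y i j)].

Definition sign_estimators : set (data -> 'cV[R]_n) :=
  [set zhat | (forall y, sign_vectors (zhat y)) /\
              (forall j, measurable_fun [set: data] (fun y => zhat y j 0))].

Definition frobenius (M : 'M[R]_n) : R :=
  Num.sqrt (\sum_(i < n) \sum_(j < n) `|M i j| ^+ 2).

Definition matrix_loss (Zhat : 'M[R]_n) (z : 'cV[R]_n) : R :=
  (n%:R ^+ 2)^-1 * frobenius (Zhat - z *m z^T) ^+ 2.

Definition vector_loss (zhat z : 'cV[R]_n) : R :=
  let l (a : R) := n%:R^-1 * \sum_(j < n) `|zhat j 0 - z j 0 * a| ^+ 2 in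
  Num.min (l (-1)) (l 1).

(* inf over the estimators in [estimators] of the sup over z of
   E_z [loss (estimator (observation)) z], in the extended reals. *)
Definition minimax_risk (sigma : R) (T : Type) (estimators : set (data -> T))
    (loss : T -> 'cV[R]_n -> R) d (Omega : measurableType d)
    (P : probability Omega R) (A : edge n -> {RV P >-> bool})
    (W : edge n -> {RV P >-> R}) : \bar R :=
  ereal_inf [set ereal_sup
    [set 'E_P[fun w => loss (est (observed sigma z A W w)) z]%E
      | z in sign_vectors]
    | est in estimators].

End Z2_synchronization.
Arguments sign_vectors {R n}.
Arguments matrix_estimators {R n}.
Arguments sign_estimators {R n}.

(* Main.v *)
From HB Require Import structures.
Require Import Defs.
From mathcomp Require Import all_boot all_order all_algebra.
From mathcomp Require Import all_classical all_reals all_analysis.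
From mathcomp Require Import measurable_realfun ring lra.

Import Order.TTheory GRing.Theory Num.Theory.
Import numFieldNormedType.Exports.
Local Open Scope classical_set_scope.
Local Open Scope ring_scope.

(** The argument is a Bayesian two-point bound, applied entry by entry.

    Fix j <> k and a sign vector z, and let z' be z with the sign of z_j
    flipped. Then z_j z_k changes sign, so for any real number x the errors
    (x - z_j z_k)^2 and (x - z'_j z'_k)^2 add up to at least 2. Hence the sum of
    the two risks of any estimator of that entry is at least twice the integral
    of the minimum of the two laws of the observation ([flip_two_point]).
    Averaging over z uniform on the cube pairs every z with its flip, and a
    supremum dominates an average: the Frobenius risk inherits the bound up to
    the factor (n-1)/n >= 1/2 ([matrix_sup_risk_ge]). An estimator zhat of z
    yields the estimator zhat zhat^T of z z^T, whose loss is at most twice that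
    of zhat ([matrix_loss_le_vector_loss]), so the second risk loses one more
    factor 2.

    It remains to bound the integral of the minimum. The two laws are compared
    with the one in which every edge at j carries pure noise. Put h_e = z_a z_b
    / sigma on the edges e = (a, b) at j, and h_e = 0 elsewhere. Translating
    the standard Gaussian noise W_e by + A_e h_e or - A_e h_e amounts to
    weighting the sample space by exp(S - Q/2) or exp(- S - Q/2), where S = sum
    A_e h_e W_e and Q = sum A_e h_e^2 ([masked_translation]); the minimum of
    the two weights is exp(- |S| - Q/2). By Jensen's inequality its expectation
    is at least exp(- E|S| - E Q / 2). Here E Q = p sum h_e^2 <= np / sigma^2
    =: M and E|S| = O(sqrt M), so the bound is exp(- M/2 - O(sqrt M))
    ([overlap_lower_bound]). Jensen is applied to the randomness of the graph
    and of the noise at once, which takes the place of a control of the vertex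
    degrees. Since delta >= C / sqrt M and M > 1, the term delta M / 2 absorbs
    both O(sqrt M) and the numerical factors ([bound_absorbs_constants]). *)

(** * Integration against a density *)

Section change_of_density.
Context {d} {T : measurableType d} {R : realType}.
Variable mu : {measure set T -> \bar R}.
Local Open Scope ereal_scope.
Import HBNNSimple.

(** The measure nu = H mu, with its integration rule: the rule holds for
    indicators by definition, hence for simple functions, and passes to the
    limit by monotone convergence. *)
Lemma density_measure (H : T -> R) :
  measurable_fun setT H -> (forall x, 0 <= H x)%R ->
  exists nu : {measure set T -> \bar R},
    (forall B, nu B = \int[mu]_(x in B) (H x)%:E) /\
    (forall f : T -> \bar R, measurable_fun setT f -> (forall x, 0 <= f x) ->
      \int[nu]_x f x = \int[mu]_x (f x * (H x)%:E)).
Proof.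
move=> mH H0.
have mHE : measurable_fun setT (EFin \o H) by exact/measurable_EFinP.
pose nu0 (B : set T) := \int[mu]_(x in B) (H x)%:E.
have nu00 : nu0 set0 = 0 by rewrite /nu0 integral_set0.
have nu0_ge0 B : 0 <= nu0 B by apply: integral_ge0 => x _; rewrite lee_fin.
have nu0_add : semi_sigma_additive nu0.
  move=> F mF tF mUF; rewrite /nu0 ge0_integral_bigcup//; last 2 first.
  - exact: measurable_funTS.
  - by move=> x _; rewrite lee_fin.
  by apply: is_cvg_ereal_nneg_natsum_cond => n _ _; exact: nu0_ge0.
pose nuM := isMeasure.Build _ _ _ nu0 nu00 nu0_ge0 nu0_add.
pose nu : {measure set T -> \bar R} := HB.pack nu0 nuM.
exists nu; split=> // f mf f0.
pose h := nnsfun_approx measurableT mf.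
have hf x : (EFin \o h^~ x) n @[n --> \oo] --> f x.
  by apply: cvg_nnsfun_approx.
have hmono x : {homo (fun n => (h n x)%:E) : m n / (m <= n)%N >-> m <= n}.
  by move=> m n mn; rewrite lee_fin; exact/lefP/nd_nnsfun_approx.
have mh n : measurable_fun setT (EFin \o h n) by exact/measurable_EFinP.
have -> : \int[nu]_x f x = limn (fun n => \int[nu]_x (h n x)%:E).
  rewrite -monotone_convergence//.
  - by apply: eq_integral => x _; apply/esym/cvg_lim => //; exact: hf.
  - by move=> n x _; rewrite lee_fin.
have -> : \int[mu]_x (f x * (H x)%:E) =
    limn (fun n => \int[mu]_x ((h n x)%:E * (H x)%:E)).
  rewrite -monotone_convergence//.
  - apply: eq_integral => x _; apply/esym/cvg_lim => //.
    exact: (cvgeZr _ (hf x)).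
  - by move=> n; apply: emeasurable_funM => //; exact: mh.
  - by move=> n x _; rewrite mule_ge0// lee_fin.
  - by move=> x _ m n mn; rewrite lee_wpmul2r// ?hmono// lee_fin.
apply/congr_lim/funext => n.
under eq_integral do rewrite fimfunE -fsumEFin//.
rewrite ge0_integral_fsum//; last 2 first.
- by move=> y; exact/measurable_EFinP/measurable_funM.
- by move=> y x _; rewrite nnfun_muleindic_ge0.
transitivity (\int[mu]_x (\sum_(y \in range (h n))
    ((H x)%:E * (y * \1_(h n @^-1` [set y]) x)%:E))); last first.
  apply: eq_integral => x _; rewrite [in RHS]fimfunE -fsumEFin// muleC.
  by rewrite ge0_mule_fsumr// => y; exact: nnfun_muleindic_ge0.
rewrite ge0_integral_fsum//; last 2 first.
- move=> y; apply: emeasurable_funM => //.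
  exact/measurable_EFinP/measurable_funM.
- move=> y x _.
  by apply: mule_ge0; [rewrite lee_fin|exact: nnfun_muleindic_ge0].
apply: eq_fsbigr => r rhn.
rewrite integralZl_indic_nnsfun// integral_indic// setIT.
have r0 : (0 <= r)%R by move: rhn; rewrite inE => -[t _ <-].
have mS : measurable (h n @^-1` [set r]) by [].
under [RHS]eq_integral do rewrite EFinM muleCA.
rewrite ge0_integralZl//; last 2 first.
- by apply: emeasurable_funM => //; exact/measurable_EFinP.
- by move=> x _; rewrite mule_ge0// lee_fin.
congr (_ * _); rewrite [LHS]integral_mkcond; apply: eq_integral => x _.
by rewrite epatch_indic.
Qed.

(** The law of X under H mu and the law of Y under K mu are equal as soon as
    they agree on measurable sets. Stating this in terms of weights on the
    sample space lets the laws be compared without constructing product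
    measures. *)
Lemma eq_integral_of_laws d' (T' : measurableType d') (X Y : T -> T')
    (H K : T -> R) (f : T' -> \bar R) :
  measurable_fun setT X -> measurable_fun setT Y ->
  measurable_fun setT H -> measurable_fun setT K ->
  (forall x, 0 <= H x)%R -> (forall x, 0 <= K x)%R ->
  (forall B, measurable B ->
    \int[mu]_(x in X @^-1` B) (H x)%:E = \int[mu]_(x in Y @^-1` B) (K x)%:E) ->
  measurable_fun setT f -> (forall y, 0 <= f y) ->
  \int[mu]_x (f (X x) * (H x)%:E) = \int[mu]_x (f (Y x) * (K x)%:E).
Proof.
move=> mX mY mH mK H0 K0 HK mf f0.
have [nu [nuE nuI]] := density_measure _ mH H0.
have [la [laE laI]] := density_measure _ mK K0.
rewrite -(nuI (f \o X)); [|exact: measurableT_comp|by move=> x; exact: f0].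
rewrite -(laI (f \o Y)); [|exact: measurableT_comp|by move=> x; exact: f0].
transitivity (\int[pushforward nu X]_y f y).
  by rewrite ge0_integral_pushforward.
transitivity (\int[pushforward la Y]_y f y); last first.
  by rewrite ge0_integral_pushforward.
- apply: eq_measure_integral => B mB _.
  by transitivity (nu (X @^-1` B)) => //; rewrite nuE HK// -laE.
Qed.

End change_of_density.

(** * Expectations of products of independent factors *)

Lemma prod_indic {R : realType} {T U : Type} {I : finType} (X : I -> T -> U)
    (B : I -> set U) (w : T) :
  \prod_i \1_(B i) (X i w) = \1_(\bigcap_(i in setT) (X i @^-1` B i)) w :> R.
Proof.
rewrite [RHS]indicE; case: (boolP (w \in _)) => [|/negP]; rewrite inE => wB.
  by rewrite big1// => i _; rewrite indicE mem_set//; exact: wB.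
apply/eqP/prodf_eq0.
have /existsNP[i] : ~ forall i, B i (X i w).
  by move=> h; apply: wB => i _; exact: h.
by move=> Bi; exists i => //; rewrite indicE memNset.
Qed.

Section expectation_of_products.
Context {d} {T : measurableType d} {R : realType} (P : probability T R).
Context {d'} {U : measurableType d'} {I : finType} (X : I -> T -> U).
Hypothesis mX : forall i, measurable_fun setT (X i).
Variable G : set T.
Hypothesis mG : measurable G.
Hypothesis indepX : forall B : I -> set U, (forall i, measurable (B i)) ->
  (P (G `&` \bigcap_(i in setT) (X i @^-1` B i)) =
   P G * \prod_i P (X i @^-1` B i))%E.
Local Open Scope ereal_scope.

Let E (phi : U -> R) i := \int[P]_w (phi (X i w))%:E.

Let factors (phi : I -> U -> R) :=
  \int[P]_w (\1_G w * \prod_i phi i (X i w))%:E = P G * \prod_i E (phi i) i.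

Let admissible (phi : I -> U -> R) := [/\ forall i, measurable_fun setT (phi i),
  forall i u, (0 <= phi i u)%R & forall i, E (phi i) i < +oo].

Let upd (phi : I -> U -> R) j (psi : U -> R) i := if i == j then psi else phi i.

Let prod_upd phi j psi w :
  (\prod_i upd phi j psi i (X i w) =
   psi (X j w) * \prod_(i | i != j) phi i (X i w))%R.
Proof.
rewrite (bigD1 j)//= /upd eqxx; congr (_ * _)%R.
by apply: eq_bigr => i /negbTE ->.
Qed.

Let prodE_upd phi j psi :
  \prod_i E (upd phi j psi i) i = E psi j * \prod_(i | i != j) E (phi i) i.
Proof.
rewrite (bigD1 j)//= /upd eqxx; congr (_ * _).
by apply: eq_bigr => i /negbTE ->.
Qed.

Let E_ge0 phi i : (forall u, 0 <= phi u)%R -> 0 <= E phi i.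
Proof. by move=> phi0; apply: integral_ge0 => w _; rewrite lee_fin. Qed.

Let updK phi j : upd phi j (phi j) = phi.
Proof. by apply/funext => i; rewrite /upd; case: eqP => [->|]. Qed.

Let E_indic B i : measurable B -> E \1_B i = P (X i @^-1` B).
Proof.
move=> mB.
have mXB : measurable (X i @^-1` B).
  by rewrite -[X in measurable X]setTI; exact: mX.
by rewrite -[X in P X]setIT -integral_indic.
Qed.

(* As functions of B, both sides of the product rule with \1_B in position j are
   measures, so the rule extends from \1_B to any factor phi j. *)
Let factors_step j phi : admissible phi ->
  (forall B, measurable B -> factors (upd phi j \1_B)) -> factors phi.
Proof.
move=> [mphi phi0 phioo] fB.
pose H w := (\1_G w * \prod_(i | i != j) phi i (X i w))%R.
have H0 w : (0 <= H w)%R by rewrite mulr_ge0// prodr_ge0.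
have mH : measurable_fun setT H.
  apply: measurable_funM; first exact: measurable_indic.
  under eq_fun do rewrite -big_filter.
  apply: measurable_prod => i _.
  exact: measurableT_comp.
have [c cE c0] : exists2 c,
    P G * \prod_(i | i != j) E (phi i) i = c%:E & (0 <= c)%R.
  have fin : P G * \prod_(i | i != j) E (phi i) i \is a fin_num.
    apply: fin_numM; first exact: fin_num_measure.
    by apply: prode_fin_num => i _; rewrite ge0_fin_numE ?E_ge0.
  exists (fine (P G * \prod_(i | i != j) E (phi i) i)); first by rewrite fineK.
  by rewrite fine_ge0// mule_ge0// prode_ge0// => i _; exact: E_ge0.
have HK B : measurable B ->
    \int[P]_(w in X j @^-1` B) (H w)%:E = \int[P]_(w in X j @^-1` B) c%:E.
  move=> mB.
  have mXB : measurable (X j @^-1` B).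
    by rewrite -[X in measurable X]setTI; exact: mX.
  transitivity (\int[P]_w (\1_G w * \prod_i upd phi j \1_B i (X i w))%:E).
    rewrite integral_mkcond; apply: eq_integral => w _.
    by rewrite prod_upd epatch_indic -EFinM mulrC mulrCA.
  rewrite (fB _ mB) prodE_upd E_indic// integral_cst// -cE -muleA.
  by congr (_ * _); exact: muleC.
rewrite -(updK phi j) /factors prodE_upd muleCA cE.
transitivity (\int[P]_w ((phi j (X j w))%:E * (H w)%:E)).
  by apply: eq_integral => w _; rewrite prod_upd -EFinM mulrCA.
rewrite (eq_integral_of_laws P _ _ (X j) (X j) H (cst c) (EFin \o phi j))//.
- rewrite -ge0_integralZr ?lee_fin//.
  + by apply/measurable_EFinP; exact: measurableT_comp.
  + by move=> w _; rewrite lee_fin.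
- exact/measurable_EFinP.
- by move=> u; rewrite lee_fin.
Qed.

(** The coordinates are independent of each other and of the event G, but this
    is assumed for events only. The indicators in the product rule are traded
    for arbitrary factors one coordinate at a time. *)
Lemma expectation_prod (phi : I -> U -> R) :
  (forall i, measurable_fun setT (phi i)) ->
  (forall i u, 0 <= phi i u)%R ->
  (forall i, \int[P]_w (phi i (X i w))%:E < +oo) ->
  \int[P]_(w in G) (\prod_i phi i (X i w))%:E =
  P G * \prod_i \int[P]_w (phi i (X i w))%:E.
Proof.
move=> mphi phi0 phioo.
suff : factors phi.
  move=> <-; rewrite integral_mkcond; apply: eq_integral => w _.
  by rewrite epatch_indic EFinM muleC.
(* s lists the coordinates whose factor need not be an indicator. *)
suff main (s : seq I) psi : admissible psi ->
    (forall i, i \notin s -> exists2 B, measurable B & psi i = \1_B) ->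
    factors psi.
  by apply: (main (enum I)) => // i; rewrite mem_enum.
elim: s psi => [|j s IHs] psi psiA psis.
  have {}psis i : exists2 B, measurable B & psi i = \1_B by exact: psis.
  have [B mB psiE] : exists2 B : I -> set U, (forall i, measurable (B i)) &
      (forall i, psi i = \1_(B i)).
    exists (fun i => sval (cid2 (psis i))) => i; by case: cid2.
  rewrite /factors.
  under [in RHS]eq_bigr do rewrite psiE E_indic//.
  rewrite -indepX//.
  have mXB i : measurable (X i @^-1` B i).
    by rewrite -[X in measurable X]setTI; exact: mX.
  rewrite -[in RHS](setIT (_ `&` _)) -integral_indic//; last first.
    by apply: measurableI => //; apply: fin_bigcap_measurable.
  apply: eq_integral => w _; congr EFin.
  rewrite indicI/= -prod_indic; congr (_ * _)%R.
  by apply: eq_bigr => i _; rewrite psiE.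
apply: (factors_step j) => // B mB; apply: IHs.
  move: psiA => [mpsi psi0 psioo]; split=> i.
  - by rewrite /upd; case: eqP => // _; exact: measurable_indic.
  - by move=> u; rewrite /upd; case: eqP.
  - rewrite /upd; case: eqP => // _; rewrite E_indic//.
    by rewrite ltey_eq fin_num_measure// -[X in measurable X]setTI; exact: mX.
move=> i isN; rewrite /upd; case: eqP => [_|/eqP ij]; first by exists B.
by apply: psis; rewrite inE negb_or ij.
Qed.

End expectation_of_products.

(** * Translations of Gaussian vectors *)

Section normal_translation.
Context {R : realType}.
Local Notation leb := (@lebesgue_measure R).

Lemma lebesgue_measure_translate (h : R) (A : set R) : measurable A ->
  leb ((fun x => x + h) @^-1` A) = leb A.
Proof.
move=> mA.
have mh : measurable_fun [set: measurableTypeR R]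
    ((fun x => x + h) : measurableTypeR R -> measurableTypeR R).
  exact: measurable_funD.
apply/esym; rewrite (@lebesgue_measure_unique R (pushforward leb
  ((fun x => x + h) : measurableTypeR R -> measurableTypeR R)))//.
move=> _ [[a b]] _ <-; rewrite /pushforward/=.
transitivity (leb `]a - h, b - h]).
  rewrite !lebesgue_measure_itv/= !lte_fin ltrD2r.
  by case: ifP => // _; rewrite -!EFinB; congr EFin; ring.
congr (leb _); apply/seteqP; split => x /=; rewrite !in_itv/=; lra.
Qed.

(** Completing the square: exp(h x - h^2/2) exp(- x^2/2) = exp(- (x - h)^2/2). *)
Lemma normal_tilt (h : R) (B : set R) : measurable B ->
  (\int[normal_prob 0 1]_(x in B) (expR (h * x - h ^+ 2 / 2))%:E =
   normal_prob 0 1 ((fun x : R => (x + h)%R) @^-1` B))%E.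
Proof.
move=> mB.
have [nu [nuE nuI]] := density_measure leb (normal_pdf 0 1)
  (measurable_normal_pdf _ _) (normal_pdf_ge0 _ _).
have mtilt : measurable_fun [set: R] (fun x => (expR (h * x - h ^+ 2 / 2))%:E).
  apply/measurable_EFinP/measurableT_comp => //; exact: measurable_funD.
rewrite (@eq_measure_integral _ _ _ _ nu); last first.
  by move=> A mA _; rewrite nuE.
rewrite integral_mkcond nuI; last 2 first.
- exact/(measurable_restrictT _ _).1/measurable_funTS.
- by move=> x; apply: erestrict_ge0 => y _; rewrite lee_fin expR_ge0.
pose shift := (fun x => x + h) : measurableTypeR R -> measurableTypeR R.
have mshift : measurable_fun setT shift by exact: measurable_funD.
transitivity (\int[leb]_(x in B) (normal_pdf 0 1 (x - h))%:E)%E.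
  rewrite [RHS]integral_mkcond; apply: eq_integral => x _.
  rewrite !patchE; case: ifP => _; last by rewrite mul0e.
  rewrite -EFinM !normal_pdfE ?oner_eq0//= mulrCA; congr (_ * _)%:E.
  rewrite /normal_fun -expRD; congr expR; by field.
transitivity (
    \int[pushforward leb shift]_(x in B) (normal_pdf 0 1 (x - h))%:E)%E.
  apply: eq_measure_integral => A mA _.
  by rewrite /= -(lebesgue_measure_translate h).
rewrite ge0_integral_pushforward//.
- by apply: eq_integral => x _; rewrite /= /shift addrK.
- apply/measurable_EFinP/measurable_funTS/measurableT_comp.
    exact: measurable_normal_pdf.
  exact: measurable_funB.
- by move=> x _; rewrite lee_fin normal_pdf_ge0.
Qed.

End normal_translation.

Lemma measurable_mktuple {d d'} {T : measurableType d} {U : measurableType d'}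
    (N : nat) (X : 'I_N -> T -> U) :
  (forall i, measurable_fun setT (X i)) ->
  measurable_fun setT (fun w => [tuple X i w | i < N]).
Proof.
move=> mX; apply/measurable_fun_tnthP => i.
rewrite [Z in measurable_fun _ Z](_ : _ = X i)//.
by apply/funext => w; rewrite /= tnth_mktuple.
Qed.

Section gaussian_vector_translation.
Context {R : realType} {N : nat}.

(** Measurable boxes, the pi-system on which two laws of random vectors are
    compared. *)
Definition boxes : set (set (N.-tuple R)) :=
  [set S | exists2 B : 'I_N -> set R, (forall i, measurable (B i)) &
    S = [set t | forall i, B i (tnth t i)]].

Lemma boxes_setI : setI_closed boxes.
Proof.
move=> _ _ [B mB ->] [C mC ->].
exists (fun i => B i `&` C i); first by move=> i; exact: measurableI.
apply/seteqP; split=> [t [tB tC] i|t tBC]; first by split.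
by split=> i; have [] := tBC i.
Qed.

Lemma boxes_setT : boxes setT.
Proof.
by exists (fun=> setT) => //; apply/seteqP; split.
Qed.

Lemma measurable_tuple_boxes : @measurable _ (N.-tuple R) = <<s boxes >>.
Proof.
apply/seteqP; split.
  apply: smallest_sub; first exact: smallest_sigma_algebra.
  rewrite -bigcup_seq/= => _ [i _ [A mA <-]]; apply: sub_sigma_algebra.
  exists (fun j => if j == i then A else setT).
    by move=> j; case: eqP.
  apply/seteqP; split=> t /=; first by move=> [_ tA] j; case: eqP => [->|].
  by move=> /(_ i); rewrite eqxx.
apply: smallest_sub; first exact: sigma_algebra_measurable.
move=> _ [B mB ->].
rewrite [X in measurable X](_ : _ =
    \bigcap_(i in setT) ((fun t => tnth t i) @^-1` B i)).
  apply: fin_bigcap_measurable => // i _.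
  by rewrite -[X in measurable X]setTI; exact: measurable_tnth.
by apply/seteqP; split=> [t tB i _|t tB i]; exact: tB.
Qed.

Context {d} {T : measurableType d} (P : probability T R) (W : 'I_N -> T -> R).
Hypothesis mW : forall i, measurable_fun setT (W i).
Hypothesis lawW : forall i B, measurable B ->
  P (W i @^-1` B) = normal_prob 0 1 B.
Variable G : set T.
Hypothesis mG : measurable G.
Hypothesis indepW : forall B : 'I_N -> set R, (forall i, measurable (B i)) ->
  (P (G `&` \bigcap_(i in setT) (W i @^-1` B i)) =
   P G * \prod_i P (W i @^-1` B i))%E.

Let tilt (h x : R) := expR (h * x - h ^+ 2 / 2).

Let mtilt h : measurable_fun setT (tilt h).
Proof. by apply: measurableT_comp => //; exact: measurable_funD. Qed.

Let E_tilt i h B : measurable B ->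
  (\int[P]_w (\1_B (W i w) * tilt h (W i w))%:E =
   P (W i @^-1` ((fun x : R => (x + h)%R) @^-1` B)))%E.
Proof.
move=> mB.
have mBh : measurable ((fun x : R => (x + h)%R) @^-1` B).
  have mh : measurable_fun setT (fun x : R => x + h) by exact: measurable_funD.
  by rewrite -[X in measurable X]setTI; exact: mh.
rewrite lawW// -normal_tilt// [RHS]integral_mkcond.
pose Wi : T -> measurableTypeR R := W i.
have mWi : measurable_fun setT Wi by exact: mW.
have mF : measurable_fun [set: R] (fun x => (\1_B x * tilt h x)%:E).
  by apply/measurable_EFinP; exact: measurable_funM.
transitivity (\int[pushforward P Wi]_x (\1_B x * tilt h x)%:E)%E.
  rewrite ge0_integral_pushforward//.
  by move=> x _; rewrite lee_fin mulr_ge0// expR_ge0.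
transitivity (\int[normal_prob 0 1]_x (\1_B x * tilt h x)%:E)%E.
  by apply: eq_measure_integral => A mA _; exact: lawW.
by apply: eq_integral => x _; rewrite epatch_indic EFinM muleC.
Qed.

(** The Cameron-Martin formula in R^N, on an event G independent of the
    Gaussian coordinates. On boxes it is the product of its one-dimensional
    instances. *)
Lemma gaussian_translation (h : 'I_N -> R) (f : N.-tuple R -> \bar R) :
  measurable_fun setT f -> (forall t, 0 <= f t)%E ->
  (\int[P]_(w in G) f [tuple (W i w + h i)%R | i < N] =
   \int[P]_(w in G) (f [tuple W i w | i < N] *
     (expR (\sum_i (h i * W i w - h i ^+ 2 / 2))%R)%:E))%E.
Proof.
move=> mf f0.
pose X w := [tuple W i w | i < N].
pose Y w := [tuple W i w + h i | i < N].
have mX : measurable_fun setT X by exact: measurable_mktuple.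
have mY : measurable_fun setT Y.
  by apply: measurable_mktuple => i; exact: measurable_funD.
pose H w := \1_G w * expR (\sum_i (h i * W i w - h i ^+ 2 / 2)).
have mH : measurable_fun setT H.
  apply: measurable_funM => //; apply: measurableT_comp => //.
  apply: measurable_sum => i; apply: measurable_funD => //.
  exact: measurable_funM.
have H0 w : 0 <= H w by rewrite mulr_ge0// expR_ge0.
have m1G : measurable_fun setT (\1_G : T -> R) by exact: measurable_indic.
rewrite [LHS]integral_mkcond [RHS]integral_mkcond.
transitivity (\int[P]_w (f (Y w) * (\1_G w)%:E))%E.
  by apply: eq_integral => w _; rewrite epatch_indic.
transitivity (\int[P]_w (f (X w) * (H w)%:E))%E; last first.
  apply: eq_integral => w _; rewrite epatch_indic -muleA EFinM.
  by congr (_ * _)%E; exact: muleC.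
apply/esym/eq_integral_of_laws => // S.
have [nu [nuE _]] := density_measure P _ mH H0.
have [la [laE _]] := density_measure P (\1_G) m1G (fun w => ltac:(done)).
have key S' : boxes S' -> nu (X @^-1` S') = la (Y @^-1` S').
  move=> [B mB ->].
  have XB : X @^-1` [set t | forall i, B i (tnth t i)] =
      \bigcap_(i in setT) (W i @^-1` B i).
    apply/seteqP; split=> [w wB i _|w wB i].
      by have := wB i; rewrite tnth_mktuple.
    by rewrite tnth_mktuple; exact: wB.
  have YB : Y @^-1` [set t | forall i, B i (tnth t i)] =
      \bigcap_(i in setT) (W i @^-1` ((fun x : R => (x + h i)%R) @^-1` B i)).
    apply/seteqP; split=> [w wB i _|w wB i].
      by have := wB i; rewrite tnth_mktuple.
    by rewrite tnth_mktuple; exact: wB.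
  have mBh i : measurable ((fun x : R => (x + h i)%R) @^-1` B i).
    have mh : measurable_fun setT (fun x : R => x + h i).
      exact: measurable_funD.
    by rewrite -[Z in measurable Z]setTI; exact: mh.
  have mWB i : measurable (W i @^-1` ((fun x : R => (x + h i)%R) @^-1` B i)).
    by rewrite -[Z in measurable Z]setTI; exact: mW.
  rewrite XB YB laE integral_indic//; last exact: fin_bigcap_measurable.
  have /= -> := indepW _ mBh; rewrite nuE.
  under eq_bigr do rewrite -E_tilt//.
  rewrite -(expectation_prod P W mW G mG indepW
    (fun i x => \1_(B i) x * tilt (h i) x)).
  - rewrite integral_mkcond [RHS]integral_mkcond; apply: eq_integral => w _.
    rewrite !epatch_indic -!EFinM big_split/= -expR_sum prod_indic.
    by rewrite /H; congr EFin; ring.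
  - by move=> i; exact: measurable_funM.
  - by move=> i x; rewrite mulr_ge0// expR_ge0.
  - by move=> i; rewrite E_tilt// ltey_eq fin_num_measure.
suff : forall S, measurable S -> pushforward nu X S = pushforward la Y S.
  by move=> + mS => /(_ S mS); rewrite /pushforward nuE laE.
apply: (measure_unique boxes (fun=> setT)).
- exact: measurable_tuple_boxes.
- exact: boxes_setI.
- by move=> _; exact: boxes_setT.
- by rewrite bigcup_const.
- by move=> S'; exact: key.
- move=> _; suff : (nu (X @^-1` setT) < +oo)%E by [].
  rewrite (key _ boxes_setT) preimage_setT laE integral_indic// setIT.
  by rewrite ltey_eq fin_num_measure.
Qed.

End gaussian_vector_translation.

(** * Two translations of a masked Gaussian vector *)

Section masked_gaussian_vector.
Context {R : realType} {d} {T : measurableType d} (P : probability T R).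
Context {N : nat}.
Variables (A : 'I_N -> T -> bool) (W : 'I_N -> T -> R).
Hypothesis mA : forall i, measurable_fun setT (A i).
Hypothesis mW : forall i, measurable_fun setT (W i).
Hypothesis lawW : forall i B, measurable B ->
  P (W i @^-1` B) = normal_prob 0 1 B.

Let At w := [tuple A i w | i < N].
Let Wt w := [tuple W i w | i < N].
Let pattern (a : N.-tuple bool) : set T :=
  \bigcap_(i in setT) (A i @^-1` [set tnth a i]).

Hypothesis indep : forall (a : N.-tuple bool) (B : 'I_N -> set R),
  (forall i, measurable (B i)) ->
  (P (pattern a `&` \bigcap_(i in setT) (W i @^-1` B i)) =
   P (pattern a) * \prod_i P (W i @^-1` B i))%E.

Let mpattern a : measurable (pattern a).
Proof.
apply: fin_bigcap_measurable => // i _.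
by rewrite -[Z in measurable Z]setTI; exact: mA.
Qed.

Let patternE a w : (w \in pattern a) = (At w == a).
Proof.
apply/idP/eqP => [|<-]; rewrite inE.
  by move=> wa; apply: eq_from_tnth => i; rewrite tnth_mktuple; exact: wa.
by move=> i _; rewrite /= tnth_mktuple.
Qed.

Let integral_patterns (g : N.-tuple bool -> T -> \bar R) :
  (forall a, measurable_fun setT (g a)) -> (forall a w, 0 <= g a w)%E ->
  (\int[P]_w g (At w) w = \sum_a \int[P]_(w in pattern a) g a w)%E.
Proof.
move=> mg g0; under [RHS]eq_bigr do rewrite integral_mkcond.
rewrite -ge0_integral_sum//.
- apply: eq_integral => w _; rewrite (bigD1 (At w))//= big1 ?adde0.
    by rewrite patchE patternE eqxx.
  by move=> a; rewrite patchE patternE eq_sym => /negbTE ->.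
- move=> a; exact/(measurable_restrictT _ (mpattern a)).1/measurable_funTS.
- by move=> a w _; exact: erestrict_ge0.
Qed.

(** The translation acts on the coordinates selected by the random mask A. On
    each of the finitely many values of the mask it is deterministic. *)
Lemma masked_translation (h : 'I_N -> R)
    (f : N.-tuple bool -> N.-tuple R -> \bar R) :
  (forall a, measurable_fun setT (f a)) -> (forall a t, 0 <= f a t)%E ->
  (\int[P]_w f (At w) [tuple (W i w + (A i w)%:R * h i)%R | i < N] =
   \int[P]_w (f (At w) (Wt w) *
     (expR (\sum_i (A i w)%:R * (h i * W i w - h i ^+ 2 / 2))%R)%:E))%E.
Proof.
move=> mf f0.
pose ha (a : N.-tuple bool) i := (tnth a i)%:R * h i.
have mWk (k : 'I_N -> R) :
    measurable_fun setT (fun w => [tuple (W i w + k i)%R | i < N]).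
  by apply: measurable_mktuple => i; exact: measurable_funD.
have mWt : measurable_fun setT Wt by exact: measurable_mktuple.
transitivity (\sum_a \int[P]_(w in pattern a)
    f a [tuple (W i w + ha a i)%R | i < N])%E.
  rewrite -(integral_patterns
    (fun a w => f a [tuple (W i w + ha a i)%R | i < N]))//.
    apply: eq_integral => w _; congr (f _ _); apply: eq_from_tnth => i.
    by rewrite !tnth_mktuple /ha tnth_mktuple.
  by move=> a; exact: measurableT_comp.
transitivity (\sum_a \int[P]_(w in pattern a) (f a (Wt w) *
     (expR (\sum_i (ha a i * W i w - ha a i ^+ 2 / 2))%R)%:E))%E.
  apply: eq_bigr => a _.
  by rewrite (gaussian_translation P W mW lawW _ (mpattern a) (indep a)).
rewrite -(integral_patterns (fun a w => f a (Wt w) *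
     (expR (\sum_i (ha a i * W i w - ha a i ^+ 2 / 2))%R)%:E)%E).
- apply: eq_integral => w _; congr (_ * (expR _)%:E)%E.
  apply: eq_bigr => i _; rewrite /ha tnth_mktuple.
  by case: (A i w); rewrite ?mul1r ?mul0r ?expr0n/= ?mul0r ?subr0.
- move=> a; apply: emeasurable_funM; first exact: measurableT_comp.
  apply/measurable_EFinP/measurableT_comp => //.
  apply: measurable_sum => i; apply: measurable_funD => //.
  exact: measurable_funM.
- by move=> a w; rewrite mule_ge0// lee_fin expR_ge0.
Qed.

Let mAr i : measurable_fun setT (fun w => (A i w)%:R : R).
Proof.
rewrite [Z in measurable_fun _ Z](_ : _ = \1_(A i @^-1` [set true])).
  by apply: measurable_indic; rewrite -[Z in measurable Z]setTI; exact: mA.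
apply/funext => w; rewrite indicE; case: (A i w) / idP => Aw.
  by rewrite mem_set.
by rewrite memNset.
Qed.

(** The likelihood ratio of the masked translation by h. *)
Let L (h : 'I_N -> R) (w : T) : R :=
  expR (\sum_i (A i w)%:R * (h i * W i w - h i ^+ 2 / 2)).

Let mL h : measurable_fun setT (L h).
Proof.
apply: measurableT_comp => //; apply: measurable_sum => i.
apply: measurable_funM => //; apply: measurable_funD => //.
exact: measurable_funM.
Qed.

Let E_L h : (\int[P]_w (L h w)%:E = 1)%E.
Proof.
have := @masked_translation h (fun _ _ => 1%E) (fun=> measurable_cst _)
  (fun _ _ => lee01).
rewrite integral_cst//= probability_setT mul1e => ->.
by apply: eq_integral => w _; rewrite mul1e.
Qed.

Variable p : R.
Hypothesis lawA : forall i, P (A i @^-1` [set true]) = p%:E.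

Let Q (h : 'I_N -> R) (w : T) : R := \sum_i (A i w)%:R * h i ^+ 2.

Let Q_ge0 h w : 0 <= Q h w.
Proof. by apply: sumr_ge0 => i _; rewrite mulr_ge0// sqr_ge0. Qed.

Let mQ h : measurable_fun setT (Q h).
Proof. by apply: measurable_sum => i; exact: measurable_funM. Qed.

Let E_Q h : (\int[P]_w (Q h w)%:E = (p * \sum_i h i ^+ 2)%:E)%E.
Proof.
under eq_integral do rewrite /Q -sumEFin.
rewrite ge0_integral_sum//; last 2 first.
- by move=> i; apply/measurable_EFinP/measurable_funM.
- by move=> i w _; rewrite lee_fin mulr_ge0// sqr_ge0.
rewrite mulr_sumr -sumEFin; apply: eq_bigr => i _.
under eq_integral do rewrite (mulrC _%:R) EFinM.
rewrite ge0_integralZl//; last 2 first.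
- exact/measurable_EFinP.
- by rewrite lee_fin sqr_ge0.
rewrite (mulrC p) [RHS]EFinM; congr (_ * _)%E.
rewrite -(lawA i) -[Z in P Z]setIT -integral_indic//.
  apply: eq_integral => w _; rewrite indicE; case: (A i w) / idP => Aw.
    by rewrite mem_set.
  by rewrite memNset.
by rewrite -[Z in measurable Z]setTI; exact: mA.
Qed.

Let S (h : 'I_N -> R) (w : T) : R := \sum_i (A i w)%:R * h i * W i w.

Let LE h s w : L (fun i => s * h i) w = expR (s * S h w - s ^+ 2 * Q h w / 2).
Proof.
congr expR; rewrite /S /Q mulr_sumr mulr_sumr mulr_suml -sumrB.
by apply: eq_bigr => i _; field.
Qed.

(** The minimum of the likelihood ratios of the translations by h and by - h. *)
Let overlap (h : 'I_N -> R) (w : T) : R := expR (- `|S h w| - Q h w / 2).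

Let mS h : measurable_fun setT (S h).
Proof.
apply: measurable_sum => i; apply: measurable_funM => //.
exact: measurable_funM.
Qed.

Let moverlap h : measurable_fun setT (overlap h).
Proof.
apply: measurableT_comp => //; apply: measurable_funB.
  by apply: measurableT_comp => //; exact: measurableT_comp.
exact: measurable_funM.
Qed.

Let overlap_le h w :
  overlap h w <= L h w /\ overlap h w <= L (fun i => - h i) w.
Proof.
have -> : L h w = L (fun i => 1 * h i) w.
  by congr (L _ w); apply/funext => i; rewrite mul1r.
have -> : L (fun i => - h i) w = L (fun i => -1 * h i) w.
  by congr (L _ w); apply/funext => i; rewrite mulN1r.
rewrite !LE /overlap !ler_expR.
have := ler_norm (S h w); have := ler_norm (- S h w).
rewrite normrN; lra.
Qed.

(** The tangent line of exp at - m is what Jensen's inequality rests on; here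
    it is kept pointwise and rearranged into nonnegative terms. The absolute
    value |S| is bounded through t |S| - t^2 Q/2 <= exp(t |S| - t^2 Q/2) - 1,
    whose exponential is at most the sum of the likelihood ratios of t h and
    - t h; these have expectation 1, so that no moment of S has to be computed. *)
Let overlap_tangent h m t w : 0 < t ->
  expR (- m) * (1 + m + t^-1) <=
  overlap h w
    + expR (- m) * t^-1 * (L (fun i => t * h i) w + L (fun i => - t * h i) w)
    + expR (- m) * ((t + 1) / 2) * Q h w.
Proof.
move=> t0.
set e := expR (- m); set l1 := L _ w; set l2 := L _ w.
have e0 : 0 < e by exact: expR_gt0.
have h1 : e * (1 + m - `|S h w| - Q h w / 2) <= overlap h w.
  have -> : overlap h w = e * expR (m - `|S h w| - Q h w / 2).
    by rewrite -expRD; congr expR; ring.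
  rewrite ler_pM2l//; have := expR_ge1Dx (m - `|S h w| - Q h w / 2); lra.
have h2 : t * `|S h w| - t ^+ 2 * Q h w / 2 <= l1 + l2 - 1.
  have : expR (t * `|S h w| - t ^+ 2 * Q h w / 2) <= l1 + l2.
    rewrite /l1 /l2 !LE sqrrN; have [s0|s0] := leP 0 (S h w).
      by rewrite ger0_norm// lerDl expR_ge0.
    by rewrite ltr0_norm// mulNr mulrN lerDr expR_ge0.
  have := expR_ge1Dx (t * `|S h w| - t ^+ 2 * Q h w / 2); lra.
have h3 : `|S h w| <= t^-1 * (l1 + l2 - 1) + t * Q h w / 2.
  have -> : `|S h w| =
      t^-1 * (t * `|S h w| - t ^+ 2 * Q h w / 2) + t * Q h w / 2.
    by field; rewrite gt_eqF.
  by rewrite lerD2r ler_pM2l// invr_gt0.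
apply: le_trans (_ :
  e * (1 + m - (t^-1 * (l1 + l2 - 1) + t * Q h w / 2) - Q h w / 2)
  + e / t * (l1 + l2) + e * ((t + 1) / 2) * Q h w <= _).
  rewrite le_eqVlt; apply/orP; left; apply/eqP; ring.
rewrite !lerD2r; apply: le_trans h1; rewrite ler_pM2l//; lra.
Qed.

Lemma overlap_lower_bound h M : 0 < M -> p * \sum_i h i ^+ 2 <= M ->
  ((expR (- (M / 2 + 3 / 2 * Num.sqrt M)))%:E <= \int[P]_w (overlap h w)%:E)%E.
Proof.
move=> M0 hM.
set m := M / 2 + _; set r := Num.sqrt M.
have r0 : 0 < r by rewrite sqrtr_gt0.
have rr : r * r = M by rewrite -expr2 sqr_sqrtr// ltW.
(* E|S| <= 1/t + t M/2, and t = 1/sqrt M makes both terms O(sqrt M). *)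
pose t := r^-1; have t0 : 0 < t by rewrite invr_gt0.
set e := expR (- m); have e0 : 0 < e by exact: expR_gt0.
have m0 : 0 <= m by rewrite /m -/r; lra.
have lhs0 : 0 <= e * (1 + m + t^-1).
  by apply: mulr_ge0; [exact: ltW|rewrite /t invrK; lra].
have et0 : 0 <= e * t^-1 by rewrite divr_ge0// ltW.
have et1 : 0 <= e * ((t + 1) / 2) by apply: mulr_ge0; lra.
pose L2 w := L (fun i => t * h i) w + L (fun i => - t * h i) w.
have L20 w : 0 <= L2 w by rewrite addr_ge0 ?expR_ge0.
have mL2 : measurable_fun setT L2 by exact: measurable_funD.
have maE : measurable_fun setT (fun w => (overlap h w)%:E).
  exact/measurable_EFinP.
have mLE k : measurable_fun setT (fun w => (L k w)%:E).
  exact/measurable_EFinP.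
have mL2E : measurable_fun setT (fun w => (L2 w)%:E) by exact/measurable_EFinP.
have mQE : measurable_fun setT (fun w => (Q h w)%:E) by exact/measurable_EFinP.
have mcL2 c : measurable_fun setT (fun w => c%:E * (L2 w)%:E)%E.
  exact: emeasurable_funM.
have mcQ c : measurable_fun setT (fun w => c%:E * (Q h w)%:E)%E.
  exact: emeasurable_funM.
have : ((e * (1 + m + t^-1))%:E <= \int[P]_w (overlap h w)%:E +
    (e * t^-1 * 2 + e * ((t + 1) / 2) * (p * \sum_i h i ^+ 2))%:E)%E.
  apply: le_trans (_ : _ <= \int[P]_w ((overlap h w)%:E +
     ((e * t^-1)%:E * (L2 w)%:E + (e * ((t + 1) / 2))%:E * (Q h w)%:E)))%E _.
    rewrite -[leLHS]mule1 -(probability_setT P) -integral_cst//.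
    apply: ge0_le_integral => //.
    - by apply: emeasurable_funD => //; exact: emeasurable_funD.
    - move=> w _; rewrite -!EFinM -!EFinD lee_fin [leRHS]addrA.
      exact: overlap_tangent.
  rewrite ge0_integralD//; last 3 first.
  - by move=> w _; rewrite lee_fin expR_ge0.
  - by move=> w _; rewrite -!EFinM -EFinD lee_fin addr_ge0// mulr_ge0.
  - exact: emeasurable_funD.
  rewrite leeD2l//.
  rewrite ge0_integralD//; last 2 first.
  - by move=> w _; rewrite -EFinM lee_fin mulr_ge0.
  - by move=> w _; rewrite -EFinM lee_fin mulr_ge0.
  rewrite !ge0_integralZl//; last 2 first.
  - by move=> w _; rewrite lee_fin.
  - by move=> w _; rewrite lee_fin.
  rewrite E_Q [X in (_ * X + _)%E](_ : _ = 2%:E)//.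
  under eq_integral do rewrite EFinD.
  by rewrite ge0_integralD ?E_L// => w _; rewrite lee_fin expR_ge0.
case: (\int[P]_w (overlap h w)%:E)%E => [x||]; last 2 first.
- by move=> _; exact: leey.
- by [].
rewrite -EFinD !lee_fin => hx.
have hq : (t + 1) / 2 * (p * \sum_i h i ^+ 2) <= (r + M) / 2.
  have -> : (r + M) / 2 = (t + 1) / 2 * M.
    by rewrite -rr /t; field; rewrite gt_eqF.
  by rewrite ler_pM2l// divr_gt0// addr_gt0.
have := ler_wpM2l (ltW e0) hq.
move: hx; rewrite /t invrK /m -/r; lra.
Qed.

(** Le Cam's method: both laws have at least the overlap as density, so the two
    risks add up to at least the overlap integrated against F1 + F2. *)
Lemma two_point_bound (h : 'I_N -> R) (M : R)
    (F1 F2 : N.-tuple bool * N.-tuple R -> R) :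
  0 < M -> p * \sum_i h i ^+ 2 <= M ->
  measurable_fun setT F1 -> measurable_fun setT F2 ->
  (forall y, 0 <= F1 y) -> (forall y, 0 <= F2 y) ->
  (forall y, 2 <= F1 y + F2 y) ->
  ((2 * expR (- (M / 2 + 3 / 2 * Num.sqrt M)))%:E <=
   \int[P]_w (F1 (At w, [tuple (W i w + (A i w)%:R * h i)%R | i < N]))%:E +
   \int[P]_w (F2 (At w, [tuple (W i w + (A i w)%:R * - h i)%R | i < N]))%:E)%E.
Proof.
move=> M0 hM mF1 mF2 F10 F20 F12.
have msec (F : N.-tuple bool * N.-tuple R -> R) a : measurable_fun setT F ->
    measurable_fun setT (fun t => (F (a, t))%:E).
  move=> mF; apply/measurable_EFinP; apply: (measurableT_comp mF).
  exact: measurable_fun_pair.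
rewrite (masked_translation h (fun a t => (F1 (a, t))%:E))//; last 2 first.
- by move=> a; exact: msec.
- by move=> a t; rewrite lee_fin.
rewrite (masked_translation (fun i => - h i) (fun a t => (F2 (a, t))%:E))//;
  last 2 first.
- by move=> a; exact: msec.
- by move=> a t; rewrite lee_fin.
have mAt : measurable_fun setT At by exact: measurable_mktuple.
have mWt : measurable_fun setT Wt by exact: measurable_mktuple.
have mFL (F : N.-tuple bool * N.-tuple R -> R) k : measurable_fun setT F ->
    measurable_fun setT (fun w => (F (At w, Wt w))%:E * (L k w)%:E)%E.
  move=> mF; apply: emeasurable_funM; apply/measurable_EFinP => //.
  by apply: (measurableT_comp mF); exact: measurable_fun_pair.
rewrite -ge0_integralD//; last 4 first.
- by move=> w _; rewrite -EFinM lee_fin mulr_ge0// expR_ge0.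
- exact: mFL.
- by move=> w _; rewrite -EFinM lee_fin mulr_ge0// expR_ge0.
- exact: mFL.
apply: (@le_trans _ _ (\int[P]_w (2%:E * (overlap h w)%:E))%E).
  rewrite ge0_integralZl//; last 2 first.
  - exact/measurable_EFinP.
  - by move=> w _; rewrite lee_fin expR_ge0.
  by rewrite EFinM lee_pmul2l//; exact: overlap_lower_bound.
apply: ge0_le_integral => //.
- by move=> w _; rewrite -EFinM lee_fin mulr_ge0// expR_ge0.
- by apply: emeasurable_funM => //; exact/measurable_EFinP.
- by apply: emeasurable_funD; exact: mFL.
move=> w _; rewrite -!EFinM -EFinD lee_fin.
have [a1 a2] := overlap_le h w.
have a0 : 0 <= overlap h w by exact: expR_ge0.
have := F12 (At w, Wt w); rewrite -/(L h w) -/(L (fun i => - h i) w).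
move=> hF; apply: le_trans (_ :
  (F1 (At w, Wt w) + F2 (At w, Wt w)) * overlap h w <= _).
  exact: ler_wpM2r.
by rewrite mulrDl lerD// ler_wpM2l.
Qed.

End masked_gaussian_vector.

(** * Flipping one sign in the synchronization model *)

Section noise_model_theory.
Context {R : realType} {n : nat} {d} {Omega : measurableType d}.
Variables (P : probability Omega R) (p : R).
Variables (A : edge n -> {RV P >-> bool}) (W : edge n -> {RV P >-> R}).
Hypotheses (p01 : 0 < p <= 1) (model : noise_model p A W).
Local Notation N := #|edge n|.
Local Notation data := (N.-tuple bool * N.-tuple R)%type.
Local Notation obs sigma z :=
  (observed sigma z (fun e => A e) (fun e => W e)).

Lemma noise_lawW e B : measurable B -> P (W e @^-1` B) = normal_prob 0 1 B.
Proof. by move=> mB; have [_ + _] := model; exact. Qed.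

Lemma noise_lawA e : P (A e @^-1` [set true]) = p%:E.
Proof.
have [lawA _ _] := model; have /andP[p0 p1] := p01.
transitivity (bernoulli_prob p [set true]); first exact: lawA.
by rewrite /bernoulli_prob (ltW p0) p1/= fsbig_set1.
Qed.

Lemma noise_indep (a : N.-tuple bool) (B : 'I_N -> set R) :
  (forall i, measurable (B i)) ->
  (P (\bigcap_(i in setT) (A (enum_val i) @^-1` [set tnth a i]) `&`
      \bigcap_(i in setT) (W (enum_val i) @^-1` B i)) =
   P (\bigcap_(i in setT) (A (enum_val i) @^-1` [set tnth a i])) *
   \prod_i P (W (enum_val i) @^-1` B i))%E.
Proof.
move=> mB; have [_ _ ind] := model.
pose Ev (i : edge n + edge n) : set Omega := match i with
  | inl e => A e @^-1` [set tnth a (enum_rank e)]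
  | inr e => W e @^-1` B (enum_rank e) end.
pose F (i : edge n + edge n) := match i with
  | inl e => sigma_of (A e) | inr e => sigma_of (W e) end.
have FEv i : F i (Ev i).
  case: i => e /=.
    by exists [set tnth a (enum_rank e)] => //; rewrite setTI.
  by exists (B (enum_rank e)); rewrite ?setTI.
pose JA := [set i : edge n + edge n | if i is inl _ then true else false]%SET.
have reix (g : edge n -> \bar R) :
    (\prod_e g e = \prod_(i < N) g (enum_val i))%E.
  rewrite (reindex (fun i : 'I_N => enum_val i))//.
  exact: onW_bij (@enum_val_bij (edge n)).
have eA : P (\bigcap_(i in setT) (A (enum_val i) @^-1` [set tnth a i])) =
    (\prod_e P (Ev (inl e)))%E.
  have := ind JA Ev (fun i _ => FEv i).
  rewrite big_sumType/= [X in (_ * X)%E]big_pred0 ?mule1; last first.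
    by move=> e; rewrite inE.
  under [X in _ = X -> _]eq_bigl do rewrite inE.
  move=> <-; congr (P _); apply/seteqP; split=> w wA.
    move=> [e|e]; rewrite /= inE// => _.
    by have := wA (enum_rank e) I; rewrite /= enum_rankK.
  move=> i _; have := wA (inl (enum_val i)); rewrite /= inE enum_valK.
  exact.
have := ind [set: edge n + edge n]%SET Ev (fun i _ => FEv i).
rewrite big_sumType/=.
under [X in _ = (X * _)%E -> _]eq_bigl do rewrite inE.
under [X in _ = (_ * X)%E -> _]eq_bigl do rewrite inE.
rewrite -eA => eAW.
rewrite (_ : _ `&` _ = \bigcap_(i in [set` [set: edge n + edge n]%SET]) Ev i).
  rewrite eAW reix; congr (_ * _)%E; apply: eq_bigr => i _.
  by rewrite /= enum_valK.
apply/seteqP; split=> w.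
  move=> [wA wW] [e|e] _ /=.
    by have := wA (enum_rank e) I; rewrite /= enum_rankK.
  by have := wW (enum_rank e) I; rewrite /= enum_rankK.
move=> wE; split=> i _.
  by have := wE (inl (enum_val i)); rewrite /= inE enum_valK; exact.
by have := wE (inr (enum_val i)); rewrite /= inE enum_valK; exact.
Qed.

Lemma measurable_masked_affine (sigma : R) (m : 'I_N -> R) :
  measurable_fun setT (fun y : data => (y.1,
    [tuple (tnth y.1 i)%:R * (m i + sigma * tnth y.2 i) | i < N]) : data).
Proof.
apply: measurable_fun_pair => //; apply: measurable_mktuple => i.
have mbool : measurable_fun setT (fun b : bool => b%:R : R) by [].
have m1 : measurable_fun setT (fun y : data => tnth y.1 i).
  exact: (measurableT_comp (measurable_tnth i) measurable_fst).
have m2 : measurable_fun setT (fun y : data => tnth y.2 i).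
  exact: (measurableT_comp (measurable_tnth i) measurable_snd).
apply: measurable_funM; first exact: (measurableT_comp mbool m1).
by apply: measurable_funD => //; exact: measurable_funM.
Qed.

Lemma measurable_observed (sigma : R) (z : 'cV[R]_n) :
  measurable_fun setT (obs sigma z).
Proof.
pose m (i : 'I_N) : R := z (val (enum_val i)).1 0 * z (val (enum_val i)).2 0.
have mAW : measurable_fun setT (fun w => ([tuple A (enum_val i) w | i < N],
    [tuple W (enum_val i) w | i < N]) : data).
  apply: measurable_fun_pair.
    apply: (@measurable_mktuple _ _ _ _ _ (fun i => A (enum_val i))) => i.
    exact: measurable_funPT.
  apply: (@measurable_mktuple _ _ _ _ _ (fun i => W (enum_val i))) => i.
  exact: measurable_funPT.
have := measurableT_comp (measurable_masked_affine sigma m) mAW.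
congr (measurable_fun _ _); apply/funext => w /=; congr (_, _).
by apply: eq_from_tnth => i; rewrite !tnth_mktuple.
Qed.

Lemma card_incident (j : 'I_n) :
  (#|[pred e : edge n | ((val e).1 == j) || ((val e).2 == j)]| <= n)%N.
Proof.
pose other (e : edge n) := if (val e).1 == j then (val e).2 else (val e).1.
rewrite -[leqRHS]card_ord -(card_in_imset (f := other)); first exact: max_card.
move=> [[a b] /= ab] [[a' b'] /= ab']; rewrite !inE /other/= => h h' o.
apply: val_inj => /=; move: ab ab' h h' o.
have [->|aj] := eqVneq a j; have [->|aj'] := eqVneq a' j => //=.
- by move=> _ _ _ _ ->.
- move=> jb a'b' _ /eqP b'j bE; move: jb a'b'; rewrite b'j bE => /ltnW.
  by rewrite leqNgt => /negP.
- move=> ab jb' /eqP bj _ aE; move: ab jb'; rewrite bj aE => /ltnW.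
  by rewrite leqNgt => /negP.
- by move=> _ _ /eqP -> /eqP -> ->.
Qed.

(** Both observations are obtained from the masked noise by the same map Phi,
    in which the edges at j have mean 0; the signal on these edges, which is
    opposite under z and z', is what the translations by h and - h supply. As h
    has squared norm at most n / sigma^2, the exponent is governed by
    M = np / sigma^2. *)
Lemma flip_two_point (sigma : R) (f : data -> R) (z z' : 'cV[R]_n)
    (j k : 'I_n) (M : R) :
  M = n%:R * p / sigma ^+ 2 -> 0 < sigma -> measurable_fun setT f ->
  sign_vectors z -> j != k ->
  (forall i, z' i 0 = if i == j then - z i 0 else z i 0) ->
  ((2 * expR (- (M / 2 + 3 / 2 * Num.sqrt M)))%:E <=
   \int[P]_w ((f (obs sigma z w) - z j 0 * z k 0) ^+ 2)%:E +
   \int[P]_w ((f (obs sigma z' w) - z' j 0 * z' k 0) ^+ 2)%:E)%E.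
Proof.
move=> ME s0 mf zs jk z'E.
pose inc (e : edge n) := ((val e).1 == j) || ((val e).2 == j).
pose zz (e : edge n) : R := z (val e).1 0 * z (val e).2 0.
pose m (i : 'I_N) : R := if inc (enum_val i) then 0 else zz (enum_val i).
pose h (i : 'I_N) : R :=
  if inc (enum_val i) then zz (enum_val i) / sigma else 0.
pose Phi (y : data) : data :=
  (y.1, [tuple (tnth y.1 i)%:R * (m i + sigma * tnth y.2 i) | i < N]).
have mPhi : measurable_fun setT Phi by exact: measurable_masked_affine.
pose s := z j 0 * z k 0.
have sqz i : z i 0 ^+ 2 = 1.
  by case: (zs i) => ->; rewrite ?sqrrN expr1n.
have sqs : s ^+ 2 = 1 by rewrite exprMn !sqz mulr1.
have s'E : z' j 0 * z' k 0 = - s.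
  by rewrite !z'E eqxx eq_sym (negbTE jk) mulNr.
pose F1 y := (f (Phi y) - s) ^+ 2.
pose F2 y := (f (Phi y) + s) ^+ 2.
have mfP : measurable_fun setT (f \o Phi) by exact: measurableT_comp.
have mF1 : measurable_fun setT F1.
  by apply: measurable_funX; apply: measurable_funB.
have mF2 : measurable_fun setT F2.
  by apply: measurable_funX; apply: measurable_funD.
have n0 : (0 < n)%N by exact: leq_ltn_trans (ltn_ord j).
have /andP[p0 p1] := p01.
have M0 : 0 < M by rewrite ME divr_gt0 ?mulr_gt0 ?ltr0n ?exprn_gt0.
have hM : p * \sum_i h i ^+ 2 <= M.
  have -> : \sum_i h i ^+ 2 = #|inc|%:R / sigma ^+ 2.
    rewrite mulr_natl -sumr_const [RHS]big_mkcond.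
    rewrite [RHS](reindex (fun i : 'I_N => enum_val i))/=; last first.
      exact: onW_bij (@enum_val_bij (edge n)).
    apply: eq_bigr => i _; rewrite /h.
    have -> : (enum_val i \in inc) = inc (enum_val i) by [].
    case: ifP => _; last by rewrite expr0n.
    by rewrite exprMn exprMn !sqz mulr1 mul1r exprVn.
  rewrite ME mulrCA mulrA ler_pM2r ?invr_gt0 ?exprn_gt0// ler_pM2r//.
  by rewrite ler_nat card_incident.
pose Ai (i : 'I_N) : Omega -> bool := A (enum_val i).
pose Wi (i : 'I_N) : Omega -> R := W (enum_val i).
have mAi i : measurable_fun setT (Ai i) by exact: measurable_funPT.
have mWi i : measurable_fun setT (Wi i) by exact: measurable_funPT.
have := two_point_bound P Ai Wi mAi mWi (fun i => @noise_lawW (enum_val i))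
  noise_indep p (fun i => noise_lawA (enum_val i)) h M F1 F2 M0 hM mF1 mF2.
move=> /(_ _ _ _)/le_trans; apply.
- by move=> y; exact: sqr_ge0.
- by move=> y; exact: sqr_ge0.
- move=> y; rewrite /F1 /F2.
  have -> : (f (Phi y) - s) ^+ 2 + (f (Phi y) + s) ^+ 2 =
    2 * s ^+ 2 + 2 * f (Phi y) ^+ 2 by ring.
  by rewrite sqs mulr1 lerDl mulr_ge0// sqr_ge0.
rewrite le_eqVlt; apply/orP; left; apply/eqP; congr (_ + _)%E.
  apply: eq_integral => w _; rewrite /F1; congr ((f _ - _) ^+ 2)%:E.
  congr (_, _); apply: eq_from_tnth => i; rewrite !tnth_mktuple.
  rewrite /Yobs /m /h /Ai /Wi -/(zz _).
  case: (A _ w); last by rewrite !mul0r.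
  by rewrite !mul1r; case: ifP => _; field; rewrite ?gt_eqF.
apply: eq_integral => w _; rewrite /F2 s'E opprK; congr ((f _ + _) ^+ 2)%:E.
congr (_, _); apply: eq_from_tnth => i; rewrite !tnth_mktuple.
rewrite /Yobs /m /h /Ai /Wi.
have -> : z' (val (enum_val i)).1 0 * z' (val (enum_val i)).2 0 =
    if inc (enum_val i) then - zz (enum_val i) else zz (enum_val i).
  rewrite /inc /zz !z'E; have := valP (enum_val i).
  have [->|_] := eqVneq _.1 j; have [->|_] := eqVneq _.2 j => //=.
  - by rewrite ltnn.
  - by rewrite mulNr.
  - by rewrite mulrN.
case: (A _ w); last by rewrite !mul0r.
by rewrite !mul1r; case: ifP => _; field; rewrite ?gt_eqF.
Qed.

(** * Averaging over the sign vectors *)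

Lemma matrix_lossE (Z : 'M[R]_n) (z : 'cV[R]_n) :
  matrix_loss Z z =
  (n%:R ^+ 2)^-1 * \sum_j \sum_k (Z j k - z j 0 * z k 0) ^+ 2.
Proof.
rewrite /matrix_loss /frobenius sqr_sqrtr; last first.
  by apply: sumr_ge0 => i _; apply: sumr_ge0 => j _; rewrite exprn_ge0.
congr (_ * _); apply: eq_bigr => i _; apply: eq_bigr => j _.
by rewrite real_normK ?num_real// !mxE big_ord1 !mxE.
Qed.

Let signs (b : {ffun 'I_n -> bool}) : 'cV[R]_n := \col_i (-1) ^+ b i.

Let flip (j : 'I_n) (b : {ffun 'I_n -> bool}) : {ffun 'I_n -> bool} :=
  [ffun i => b i (+) (i == j)].

Let signsP b : sign_vectors (signs b).
Proof. by move=> j; rewrite !mxE; case: (b j); [left|right]. Qed.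

Let flipK j : involutive (flip j).
Proof. by move=> b; apply/ffunP => i; rewrite !ffunE addbK. Qed.

Let flipE j b i :
  signs (flip j b) i 0 = if i == j then - signs b i 0 else signs b i 0.
Proof.
rewrite !mxE ffunE; case: eqP => _; last by rewrite addbF.
by rewrite addbT; case: (b i); rewrite /= ?expr0 ?expr1 ?opprK.
Qed.

Let risk sigma (Z : data -> 'M[R]_n) b j k :=
  (\int[P]_w ((Z (obs sigma (signs b) w) j k
      - signs b j 0 * signs b k 0) ^+ 2)%:E)%E.

Let risk_ge0 sigma Z b j k : (0 <= risk sigma Z b j k)%E.
Proof. by apply: integral_ge0 => w _; rewrite lee_fin sqr_ge0. Qed.

Let sum_risk_ge sigma Z M j k : M = n%:R * p / sigma ^+ 2 -> 0 < sigma ->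
  matrix_estimators Z -> j != k ->
  ((#|{ffun 'I_n -> bool}|%:R * expR (- (M / 2 + 3 / 2 * Num.sqrt M)))%:E <=
   \sum_b risk sigma Z b j k)%E.
Proof.
move=> ME s0 mZ jk; set e := expR _.
have h : (\sum_(b : {ffun 'I_n -> bool}) (2 * e)%:E <=
    \sum_b risk sigma Z b j k + \sum_b risk sigma Z b j k)%E.
  rewrite [X in (_ <= _ + X)%E](reindex_inj (inv_inj (flipK j)))/= -big_split/=.
  apply: lee_sum => b _.
  exact: (flip_two_point sigma (fun y => Z y j k) _ _ _ _ _ ME s0 (mZ j k)
    (signsP b) jk (flipE j b)).
rewrite -(@lee_pmul2l _ 2%:E)// -EFinM mulrCA.
apply: (le_trans _ (le_trans h _)).
  by rewrite sumEFin sumr_const -(mulr_natl (2 * e)) lee_fin; exact: lexx.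
by rewrite (mule_natl _ 2) mule2n lexx.
Qed.

(** The diagonal entries are trivial to estimate, which is why only n (n - 1)
    of the n^2 entries contribute; at most half of the overlap is lost, as n >= 2. *)
Lemma matrix_sup_risk_ge sigma (Z : data -> 'M[R]_n) M : (1 < n)%N ->
  M = n%:R * p / sigma ^+ 2 -> 0 < sigma -> matrix_estimators Z ->
  ((expR (- (M / 2 + 3 / 2 * Num.sqrt M)) / 2)%:E <= ereal_sup
    [set 'E_P[fun w => matrix_loss (Z (obs sigma z w)) z]
      | z in sign_vectors])%E.
Proof.
move=> n1 ME s0 mZ; set e := expR _; set s := ereal_sup _.
pose K := #|{ffun 'I_n -> bool}|.
have K0 : (0 < K)%N by apply/card_gt0P; exists [ffun=> true].
have n0 : 0 < n%:R :> R by rewrite ltr0n ltnW.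
have mobs z j k : measurable_fun setT
    (fun w => Z (obs sigma z w) j k).
  exact: (measurableT_comp (mZ j k) (measurable_observed sigma z)).
have riskE b : ('E_P[fun w => matrix_loss (Z (obs sigma (signs b) w)) (signs b)]
    = ((n%:R ^+ 2)^-1)%:E * \sum_j \sum_k risk sigma Z b j k)%E.
  rewrite unlock.
  have mterm j k : measurable_fun setT (fun w => (Z (obs sigma (signs b) w) j k
      - signs b j 0 * signs b k 0) ^+ 2).
    by apply: measurable_funX; exact: measurable_funB.
  under eq_integral do rewrite matrix_lossE EFinM.
  rewrite ge0_integralZl//; last 2 first.
  - by apply/measurable_EFinP; do 2![apply: measurable_sum => ?].
  - move=> w _; rewrite lee_fin; apply: sumr_ge0 => j _.
    by apply: sumr_ge0 => k _; exact: sqr_ge0.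
  congr (_ * _)%E.
  under eq_integral do rewrite -sumEFin.
  rewrite ge0_integral_sum//; last 2 first.
  - by move=> j; apply/measurable_EFinP; exact: measurable_sum.
  - by move=> j w _; rewrite lee_fin; apply: sumr_ge0 => k _; exact: sqr_ge0.
  apply: eq_bigr => j _.
  under eq_integral do rewrite -sumEFin.
  rewrite ge0_integral_sum//.
  - by move=> k; exact/measurable_EFinP.
  - by move=> k w _; rewrite lee_fin sqr_ge0.
have Ks : (\sum_b
   ('E_P[fun w => matrix_loss (Z (obs sigma (signs b) w)) (signs b)])
   <= K%:R%:E * s)%E.
  apply: (le_trans (lee_sum _ (_ : forall b, true -> _ <= s)%E)).
    by move=> b _; apply: ereal_sup_ubound; exists (signs b).
  by rewrite sumr_const mule_natl.
rewrite -(@lee_pmul2l _ K%:R%:E)//; last by rewrite lte_fin ltr0n.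
apply: le_trans Ks.
under eq_bigr do rewrite riskE.
rewrite -ge0_sume_distrr; last first.
  move=> b _; apply: sume_ge0 => j _; apply: sume_ge0 => k _.
  exact: risk_ge0.
have -> : (\sum_b \sum_j \sum_k risk sigma Z b j k =
    \sum_j \sum_k \sum_b risk sigma Z b j k)%E.
  rewrite exchange_big/=; apply: eq_bigr => j _; exact: exchange_big.
apply: (@le_trans _ _ (((n%:R ^+ 2)^-1)%:E *
  \sum_(j < n) \sum_(k < n) ((j != k)%:R * (K%:R * e))%:E)%E).
  under eq_bigr do rewrite sumEFin.
  rewrite sumEFin -!EFinM lee_fin.
  have sumk j : \sum_(k < n) (j != k)%:R * (K%:R * e) = (n%:R - 1) * (K%:R * e).
    rewrite -mulr_suml -natr_sum; congr (_ * _).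
    rewrite -(@natrB _ n 1) ?(ltnW n1)// subn1.
    suff -> : (\sum_(k < n) (j != k) = n.-1)%N by [].
    rewrite -[in RHS](card_ord n) -(cardC1 j) -sum1_card [RHS]big_mkcond/=.
    by apply: eq_bigr => k _; rewrite !inE eq_sym; case: eqP.
  under eq_bigr do rewrite sumk.
  rewrite sumr_const card_ord -(mulr_natl ((n%:R - 1) * _) n).
  have -> : (n%:R ^+ 2)^-1 * (n%:R * ((n%:R - 1) * (K%:R * e))) =
    (K%:R * e) * ((n%:R - 1) / n%:R) by field; rewrite gt_eqF.
  rewrite mulrA ler_pM2l ?mulr_gt0 ?ltr0n ?expR_gt0//.
  rewrite ler_pdivlMr// ; have : 2 <= n%:R :> R by rewrite (ler_nat _ 2).
  lra.
rewrite lee_pmul2l ?lte_fin ?invr_gt0 ?exprn_gt0//.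
apply: lee_sum => j _; apply: lee_sum => k _.
have [jk|jk] := eqVneq j k; rewrite /= ?mul0r ?mul1r.
  by apply: sume_ge0 => b _; exact: risk_ge0.
exact: sum_risk_ge.
Qed.

(** * From matrices to sign vectors *)

(** With u the inner product of zhat and z, the two losses are 2 (1 - u^2/n^2)
    and, before minimizing over the sign a, 2 (1 - a u/n), so the inequality is
    0 <= (n - a u)^2. *)
Lemma matrix_loss_le_vector_loss (zhat z : 'cV[R]_n) : (0 < n)%N ->
  sign_vectors zhat -> sign_vectors z ->
  matrix_loss (zhat *m zhat^T) z <= 2 * vector_loss zhat z.
Proof.
move=> n0 shat sz.
have n0R : 0 < n%:R :> R by rewrite ltr0n.
have sq (x : 'cV[R]_n) j : sign_vectors x -> x j 0 ^+ 2 = 1.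
  by move=> sx; case: (sx j) => ->; rewrite ?sqrrN expr1n.
pose u := \sum_j zhat j 0 * z j 0.
have vecE a : a ^+ 2 = 1 ->
    \sum_(j < n) `|zhat j 0 - z j 0 * a| ^+ 2 = 2 * n%:R - 2 * a * u.
  move=> a1; rewrite /u mulr_sumr -[n%:R](_ : \sum_(j < n) 1 = _); last first.
    by rewrite sumr_const card_ord.
  rewrite mulr_sumr -sumrB; apply: eq_bigr => j _.
  rewrite real_normK ?num_real// sqrrB exprMn a1 !sq//; ring.
have matE : \sum_j \sum_k ((zhat *m zhat^T) j k - z j 0 * z k 0) ^+ 2 =
    2 * n%:R ^+ 2 - 2 * u ^+ 2.
  transitivity (\sum_(j < n) \sum_(k < n)
      (2 - 2 * ((zhat j 0 * z j 0) * (zhat k 0 * z k 0)))).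
    apply: eq_bigr => j _; apply: eq_bigr => k _.
    rewrite !mxE big_ord1 !mxE sqrrB !exprMn !sq//; ring.
  under eq_bigr do rewrite sumrB sumr_const card_ord -!mulr_sumr -/u.
  rewrite sumrB sumr_const card_ord -mulr_sumr -mulr_suml -/u.
  by rewrite -[2 *+ n *+ n]mulr_natr -[2 *+ n]mulr_natr; ring.
have key a : a ^+ 2 = 1 -> matrix_loss (zhat *m zhat^T) z <=
    2 * (n%:R^-1 * \sum_(j < n) `|zhat j 0 - z j 0 * a| ^+ 2).
  move=> a1; rewrite matrix_lossE matE vecE//.
  rewrite -(@ler_pM2l _ (n%:R ^+ 2)) ?exprn_gt0// mulVKf ?gt_eqF ?exprn_gt0//.
  have -> : n%:R ^+ 2 * (2 * (n%:R^-1 * (2 * n%:R - 2 * a * u))) =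
     2 * n%:R * (2 * n%:R - 2 * a * u) by field; rewrite gt_eqF.
  have := sqr_ge0 (n%:R - a * u); rewrite sqrrB exprMn a1; nra.
rewrite /vector_loss /Num.min; case: ifP => _; apply: key.
  by rewrite sqrrN expr1n.
by rewrite expr1n.
Qed.

Lemma vector_sup_risk_ge sigma (zhat : data -> 'cV[R]_n) M : (1 < n)%N ->
  M = n%:R * p / sigma ^+ 2 -> 0 < sigma -> sign_estimators zhat ->
  ((expR (- (M / 2 + 3 / 2 * Num.sqrt M)) / 4)%:E <= ereal_sup
    [set 'E_P[fun w => vector_loss (zhat (obs sigma z w)) z]
      | z in sign_vectors])%E.
Proof.
move=> n1 ME s0 [shat mhat]; set e := expR _; set s := ereal_sup _.
pose Z y := zhat y *m (zhat y)^T.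
have ZE y j k : Z y j k = zhat y j 0 * zhat y k 0 by rewrite !mxE big_ord1 !mxE.
have mZ : matrix_estimators Z.
  by move=> j k; under eq_fun do rewrite ZE; exact: measurable_funM.
rewrite -(@lee_pmul2l _ 2%:E)// -EFinM.
have -> : 2 * (e / 4) = e / 2 by field.
apply: le_trans (matrix_sup_risk_ge sigma Z M n1 ME s0 mZ) _.
apply: ge_ereal_sup => _ [z sz <-].
have mobs j : measurable_fun setT
    (fun w => zhat (obs sigma z w) j 0).
  exact: (measurableT_comp (mhat j) (measurable_observed sigma z)).
have mv : measurable_fun setT (fun w =>
    vector_loss (zhat (obs sigma z w)) z).
  apply: measurable_minr; apply: measurable_funM => //;
    apply: measurable_sum => j; apply: measurable_funX;
    apply: measurableT_comp => //; exact: measurable_funB.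
have v0 x : 0 <= vector_loss x z.
  rewrite /vector_loss /Num.min; case: ifP => _;
    by rewrite mulr_ge0 ?invr_ge0// sumr_ge0// => j _; rewrite exprn_ge0.
apply: (@le_trans _ _
  (2%:E * 'E_P[fun w => vector_loss (zhat (obs sigma z w)) z])%E); last first.
  by rewrite lee_pmul2l//; apply: ereal_sup_ubound; exists z.
rewrite unlock -ge0_integralZl//; last 2 first.
- exact/measurable_EFinP.
- by move=> w _; rewrite lee_fin.
apply: ge0_le_integral => //.
- by move=> w _; rewrite lee_fin mulr_ge0 ?invr_ge0// exprn_ge0// sqrtr_ge0.
- apply/measurable_EFinP; under eq_fun do rewrite matrix_lossE.
  apply: measurable_funM => //; do 2![apply: measurable_sum => ?].
  apply: measurable_funX; apply: measurable_funB => //.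
  exact: (measurableT_comp (mZ _ _) (measurable_observed sigma z)).
- by apply: emeasurable_funM => //; exact/measurable_EFinP.
by move=> w _; rewrite -EFinM lee_fin matrix_loss_le_vector_loss// ltnW.
Qed.

End noise_model_theory.

(** * Conclusion *)

(** With L = ln n, np and s2 = sigma^2: delta is at least 10 / sqrt M, so delta
    M / 2 >= 5 sqrt M. Of this 3/2 sqrt M pays for the overlap, and the
    remaining 7/2 sqrt M >= 7/2 pays for the factor 1/4, because exp (7/2) >= 1
    + 7/2 >= 4. *)
Lemma bound_absorbs_constants (R : realType) (L np s2 M : R) :
  0 <= L -> 0 < s2 -> 0 < np -> M = np / s2 -> 1 < M ->
  expR (- (1 + 10 * Num.sqrt ((L + s2) / np)) * (np / (2 * s2))) <=
  expR (- (M / 2 + 3 / 2 * Num.sqrt M)) / 4.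
Proof.
move=> L0 s20 np0 ME M1.
have M0 : 0 < M by lra.
set r := Num.sqrt M; set t := Num.sqrt _.
have r1 : 1 <= r by rewrite -sqrtr1 ler_sqrt// ltW.
have rr : r * r = M by rewrite -expr2 sqr_sqrtr// ltW.
have tr : r^-1 <= t.
  rewrite /r /t -sqrtrV ?(ltW M0)//; apply: ler_wsqrtr.
  by rewrite ME invf_div ler_pM2r ?invr_gt0// lerDr.
have trM : r <= t * M.
  have -> : r = r^-1 * M by rewrite -rr mulKf// gt_eqF// (lt_le_trans _ r1).
  by rewrite ler_pM2r.
have -> : np / (2 * s2) = M / 2 by rewrite ME; field; rewrite gt_eqF.
have e4 : expR (- (7 / 2)) <= 4^-1 :> R.
  rewrite expRN lef_pV2 ?posrE ?expR_gt0//.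
  by apply: le_trans (expR_ge1Dx _); lra.
apply: (@le_trans _ _ (expR (- (M / 2 + 3 / 2 * r)) * expR (- (7 / 2)))).
  rewrite -expRD ler_expR; nra.
by rewrite ler_pM2l ?expR_gt0.
Qed.

Theorem theorem4p1 (R : realType) :
  exists c1 c2 C : R, [/\ 0 < c1, 0 < c2, 0 < C &
    forall (n : nat) (sigma p : R),
      (1 < n)%N -> 0 < sigma -> 0 < p <= 1 ->
      n%:R * p / sigma ^+ 2 > c1 ->
      n%:R * p / ln n%:R > c2 ->
    forall (d : measure_display) (Omega : measurableType d)
      (P : probability Omega R)
      (A : edge n -> {RV P >-> bool}) (W : edge n -> {RV P >-> R}),
      noise_model p A W ->
      let delta := C * Num.sqrt ((ln n%:R + sigma ^+ 2) / (n%:R * p)) in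
      let bound := expR (- (1 + delta) * (n%:R * p / (2 * sigma ^+ 2))) in
      (minimax_risk sigma matrix_estimators (@matrix_loss R n) A W >= bound%:E)%E
      /\
      (minimax_risk sigma sign_estimators (@vector_loss R n) A W >= bound%:E)%E].
Proof.
exists 1, 1, 10; split=> //.
move=> n sigma p n1 s0 p01 M1 _ d Omega P A W model delta bound.
have /andP[p0 _] := p01.
set M := n%:R * p / sigma ^+ 2 in M1.
have hb : bound <= expR (- (M / 2 + 3 / 2 * Num.sqrt M)) / 4.
  apply: (bound_absorbs_constants R (ln n%:R)) => //.
  - by rewrite ln_ge0// ler1n ltnW.
  - by rewrite exprn_gt0.
  - by rewrite mulr_gt0// ltr0n ltnW.
split; apply: le_ereal_inf_tmp => _ [est mest <-].
  apply: le_trans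
    (matrix_sup_risk_ge P p A W p01 model sigma est M n1 erefl s0 mest).
  rewrite lee_fin; apply: (le_trans hb); rewrite ler_pM2l ?expR_gt0//.
  by rewrite lef_pV2 ?posrE//; lra.
apply: le_trans
  (vector_sup_risk_ge P p A W p01 model sigma est M n1 erefl s0 mest).
by rewrite lee_fin.
Qed.
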